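(* Let $n\le m$, let $\mathcal{A}\colon\mathbf{M}^{n\times m}\to\mathbb{R}^d$ be a linear operator, $b\in\mathbb{R}^d$, and $\theta>0$. Consider the optimization problem $$\min\ \|X\|_1+\theta\|X\|_*\quad\text{subject to}\quad \mathcal{A}(X)=b .$$ Then any extreme point $\overline{X}$ of the solution set (the set of minimizers) satisfies $$\frac{\bar r(\bar r+1)}{2}-|\bar I|\le 1+d,$$ where $\bar r$ is the rank of $\overline{X}$ and $\bar I=\{(i,j):\overline{X}_{i,j}=0\}$ is the index set of the zero entries of $\overline{X}$.
   Context: $\mathbf{M}^{n\times m}$ is the space of real $n\times m$ matrices; $\|X\|_1=\sum_{i,j}|X_{i,j}|$ is the entrywise $l_1$-norm and $\|X\|_*$ is the nuclear norm (sum of singular values). *)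

(* Defs.v *)
From HB Require Import structures.
From mathcomp Require Import all_boot all_order all_algebra.
From mathcomp Require Import classical_sets reals.
From mathcomp Require Import polyrcf.

Set Implicit Arguments.
Unset Strict Implicit.
Unset Printing Implicit Defensive.

Import Order.TTheory GRing.Theory Num.Theory.
Local Open Scope classical_set_scope.
Local Open Scope ring_scope.

Definition l1_norm (R : realType) (n m : nat) (X : 'M[R]_(n, m)) : R :=
  \sum_(i < n) \sum_(j < m) `|X i j|.

(* The square roots of the eigenvalues of [X *m X^T], each repeated according
   to its algebraic multiplicity. There are [n] of them: for [n <= m] these
   are the [minn n m] singular values of [X], and for [m < n] the list only
   contains [n - m] additional zeros. *)
Definition singular_values (R : realType) (n m : nat) (X : 'M[R]_(n, m)) :
    seq R :=
  let p := char_poly (X *m X^T) in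
  flatten [seq nseq (mup x p) (Num.sqrt x) | x <- rootsR p].

Definition nuclear_norm (R : realType) (n m : nat) (X : 'M[R]_(n, m)) : R :=
  \sum_(s <- singular_values X) s.

Definition objective (R : realType) (n m : nat) (theta : R)
    (X : 'M[R]_(n, m)) : R :=
  l1_norm X + theta * nuclear_norm X.

Definition feasible_set (R : realType) (n m d : nat)
    (A : {linear 'M[R]_(n, m) -> 'cV[R]_d}) (b : 'cV[R]_d) :
    set 'M[R]_(n, m) :=
  [set X | A X = b].

Definition minimizers (R : realType) (T : Type) (f : T -> R) (D : set T) :
    set T :=
  [set x | D x /\ forall y, D y -> f x <= f y].

Definition extreme_point (R : realType) (V : lmodType R) (S : set V) (x : V) :
    Prop :=
  S x /\
  forall (y z : V) (t : R), S y -> S z -> 0 < t -> t < 1 ->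
    x = t *: y + (1 - t) *: z -> y = x /\ z = x.

Definition zero_entries (R : realType) (n m : nat) (X : 'M[R]_(n, m)) :
    {set 'I_n * 'I_m} :=
  [set ij | X ij.1 ij.2 == 0]%SET.

(* Main.v *)
From HB Require Import structures.
Require Import Defs.
From mathcomp Require Import all_boot all_order all_algebra.
From mathcomp Require Import classical_sets reals.
From mathcomp Require Import complex polyrcf ring lra.

Set Implicit Arguments.
Unset Strict Implicit.
Unset Printing Implicit Defensive.

Import Order.TTheory GRing.Theory Num.Theory.
Local Open Scope ring_scope.

(* Write [X = O^T Sigma Z] with [O] orthogonal, [Sigma] diagonal nonnegative and
   [Z Z^T] the projection onto the support [S] of [Sigma], so that
   [\rank X <= #|S|]. For [K] symmetric and supported on [S x S], put
   [D = O^T K Z]. Then [X + t D = (O^T (Sigma + t K) O) (O^T Z)] is a polar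
   decomposition for small [t], hence its nuclear norm [\tr (Sigma + t K)] is
   affine in [t]; so is the l1-norm as soon as [D] vanishes on the zero entries
   of [X]. If moreover [A D = 0], the objective is affine on a feasible segment
   with the minimizer [X] in its middle, hence constant on it, and extremality
   forces [D = 0]. The [K] form a space of dimension [#|S| (#|S| + 1) / 2], on
   which there are [d + #|zero_entries X|] linear conditions, so that
   [\rank X (\rank X + 1) / 2 <= d + #|zero_entries X|]. *)

(** * Spectral theorem for real symmetric matrices *)

Lemma symmetric_eigenvalue (R : rcfType) n (A : 'M[R]_n.+1) :
  A^T = A -> exists a, eigenvalue A a.
Proof.
move=> symA; pose Ac := map_mx (real_complex R) A.
have [z z_eig] := eigenvalue_closed Ac isT.
have /eigenvalueP[v vA v0] := z_eig.
pose w := (map_mx Num.conj v)^T.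
have AcT : Ac^T = Ac by rewrite map_trmx symA.
have AcJ : map_mx Num.conj Ac = Ac.
  apply/matrixP => i j; rewrite !mxE conj_Creal //.
  by apply/complex_realP; exists (A i j).
have Aw : Ac *m w = Num.conj z *: w.
  by rewrite /w -[in LHS]AcT -trmx_mul -linearZ -map_mxZ -vA map_mxM AcJ.
have vw0 : (v *m w) 0 0 != 0.
  apply: contra v0; rewrite mxE psumr_eq0 => [|j _]; last first.
    by rewrite !mxE mul_conjC_ge0.
  move=> /allP vw; apply/eqP/rowP => j; apply/eqP; rewrite mxE.
  by have := vw j (mem_index_enum j); rewrite /= !mxE mul_conjC_eq0.
(* Evaluating [v *m Ac *m w] in both orders gives [z] and its conjugate times the same nonzero
   scalar [v *m w]. *)
have zJ : Num.conj z = z.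
  apply: (mulIf vw0); have := mulmxA v Ac w.
  by rewrite vA Aw -scalemxAl -scalemxAr => /matrixP /(_ 0 0); rewrite mxE [RHS]mxE.
have /complex_realP[a za] : z \is Num.real by rewrite CrealE zJ.
by exists a; move: z_eig; rewrite za (eigenvalue_map (real_complex R)).
Qed.

Lemma row_dot_eq0 (R : realDomainType) n (w : 'rV[R]_n) :
  ((w *m w^T) 0 0 == 0) = (w == 0).
Proof.
apply/idP/eqP => [|->]; last by rewrite mul0mx mxE.
rewrite mxE psumr_eq0 => [|j _]; last by rewrite mxE -expr2 sqr_ge0.
move=> /allP w0; apply/rowP => j; apply/eqP; rewrite mxE.
by have := w0 j (mem_index_enum j); rewrite /= mxE mulf_eq0 orbb.
Qed.

(* Householder reflection along [u - e], with [e] the first basis vector. *)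
Lemma orthogonal_with_first_row (R : realFieldType) n (u : 'rV[R]_n.+1) :
    u *m u^T = 1%:M ->
  exists2 H : 'M[R]_n.+1, H *m H^T = 1%:M & delta_mx 0 0 *m H = u.
Proof.
move=> uu; pose e : 'rV[R]_n.+1 := delta_mx 0 0.
have ee : e *m e^T = 1%:M.
  rewrite trmx_delta mul_delta_mx; apply/matrixP => i j.
  by rewrite !ord1 !mxE.
have [->|ue] := eqVneq u e; first by exists 1%:M; rewrite ?trmx1 mulmx1.
have [w uE] : exists w, u = w + e by exists (u - e); rewrite subrK.
pose c := (w *m e^T) 0 0.
have we : w *m e^T = c%:M by exact: mx11_scalar.
have ew : e *m w^T = c%:M by rewrite -[LHS]trmxK trmx_mul trmxK we tr_scalar_mx.
have ww : w *m w^T = (- (2 * c))%:M.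
  move: uu; rewrite uE linearD /= mulmxDr !mulmxDl we ew ee => /matrixP/(_ 0 0).
  rewrite [w *m w^T]mx11_scalar !mxE eqxx /= => eq1.
  by congr _%:M; lra.
have c0 : c != 0.
  apply: contra_neq ue => c0; rewrite uE; suff -> : w = 0 by rewrite add0r.
  by apply/eqP; rewrite -row_dot_eq0 ww c0 mulr0 oppr0 mxE.
(* As the squared norm of [w] is [- (2 * c)], this is the reflection [1 - 2 w^T w / |w|^2]. *)
pose H := 1%:M + c^-1 *: (w^T *m w).
have HT : H^T = H by rewrite linearD linearZ /= trmx1 trmx_mul trmxK.
exists H.
  rewrite HT mulmxDl mul1mx mulmxDr mulmx1 -scalemxAl -scalemxAr.
  rewrite mulmxA -[w^T *m w *m w^T]mulmxA ww mul_mx_scalar -scalemxAl.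
  rewrite !scalerA /H -addrA -!scalerDl [X in X *: _](_ : _ = 0) ?scale0r ?addr0 //.
  by field.
by rewrite mulmxDr mulmx1 -scalemxAr mulmxA ew mul_scalar_mx scalerA mulVf // scale1r addrC.
Qed.

(** Deflation: an orthogonal [H] whose first row is a unit eigenvector conjugates [A] to a symmetric
    matrix with first row [(a, 0)], hence block diagonal, and the induction applies to the lower
    block. *)
Lemma symmetric_spectral (R : rcfType) n (A : 'M[R]_n) : A^T = A ->
  exists (O : 'M[R]_n) (d : 'rV[R]_n), [/\ O *m O^T = 1%:M, O^T *m O = 1%:M & A = O^T *m diag_mx d *m O].
Proof.
elim: n A => [|n IHn] A symA.
  by exists 1%:M, 0; split; apply/matrixP => -[].
have [a /eigenvalueP[v vA v0]] := symmetric_eigenvalue symA.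
pose s := (v *m v^T) 0 0.
have s_gt0 : 0 < s.
  rewrite lt0r row_dot_eq0 v0 /s mxE sumr_ge0 // => j _.
  by rewrite mxE -expr2 sqr_ge0.
pose u := (Num.sqrt s)^-1 *: v.
have uA : u *m A = a *: u by rewrite -scalemxAl vA !scalerA mulrC.
have uu : u *m u^T = 1%:M.
  rewrite linearZ /= -scalemxAr -scalemxAl scalerA [_ *m _]mx11_scalar -/s.
  rewrite -mul_scalar_mx -scalar_mxM -invfM -expr2 sqr_sqrtr ?ltW // mulVf //.
  by rewrite gt_eqF.
have [H HHT eH] := orthogonal_with_first_row uu.
have HTH : H^T *m H = 1%:M by exact: mulmx1C.
have [B defB] : exists B : 'M_(1 + n), B = H *m A *m H^T by eexists.
have symB : B^T = B by rewrite defB !trmx_mul trmxK symA mulmxA.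
have eB : delta_mx 0 0 *m B = a *: delta_mx 0 0 :> 'rV_n.+1.
  rewrite defB !mulmxA eH uA -scalemxAl -eH -mulmxA.
  by rewrite (HHT : _ = 1%:M) mulmx1.
pose B' := drsubmx B.
have B0 (i j : 'I_(1 + n)) : i = 0%N :> nat -> B i j = a * (j == 0%N :> nat)%:R.
  move=> i0; have -> : i = 0 by exact: val_inj.
  by move/matrixP: eB => /(_ 0 j); rewrite -rowE !mxE => ->.
have BE : B = block_mx a%:M 0 0 B'.
  rewrite -[B]submxK; congr block_mx; apply/matrixP => i j.
  - by rewrite !ord1 !mxE B0 // mulr1.
  - by rewrite !ord1 !mxE B0 // mulr0.
  - by rewrite !ord1 -symB !mxE B0 // mulr0.
have [|O [d [OOT OTO B'E]]] := IHn B'.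
  by rewrite /B' trmx_drsub symB.
pose O1 : 'M_(1 + n) := block_mx 1%:M 0 0 O.
exists (O1 *m H), (row_mx a%:M d : 'rV_(1 + n)).
have O1T : O1^T = block_mx 1%:M 0 0 O^T by rewrite tr_block_mx !trmx0 trmx1.
have O1O : O1 *m O1^T = 1%:M.
  by rewrite O1T mulmx_block OOT !mulmx0 !mul0mx !addr0 add0r mulmx1 -scalar_mx_block.
have OO1 : O1^T *m O1 = 1%:M by exact: mulmx1C.
split.
- by rewrite trmx_mul mulmxA -[O1 *m H *m H^T]mulmxA HHT mulmx1.
- by rewrite trmx_mul mulmxA -[H^T *m O1^T *m O1]mulmxA OO1 mulmx1.
have -> : A = H^T *m B *m H by rewrite defB !mulmxA HTH mul1mx -mulmxA HTH mulmx1.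
have dE : diag_mx (row_mx a%:M d : 'rV_(1 + n)) = block_mx a%:M 0 0 (diag_mx d).
  rewrite diag_mx_row; congr block_mx.
  by apply/matrixP => i j; rewrite !mxE !ord1.
have -> : B = O1^T *m diag_mx (row_mx a%:M d : 'rV_(1 + n)) *m O1.
  by rewrite BE O1T dE !mulmx_block B'E !(mulmx0, mul0mx, addr0, add0r, mulmx1, mul1mx).
by rewrite trmx_mul !mulmxA.
Qed.

(** * Nuclear norm and singular value decomposition *)

Lemma char_poly_conj (R : comNzRingType) n (P Q A : 'M[R]_n) :
  Q *m P = 1%:M -> char_poly (P *m A *m Q) = char_poly A.
Proof.
move=> QP; have PQ : P *m Q = 1%:M by exact: mulmx1C.
pose p := map_mx polyC P; pose q := map_mx polyC Q.
have qp : q *m p = 1%:M by rewrite -map_mxM QP map_mx1.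
have pq : p *m q = 1%:M by rewrite -map_mxM PQ map_mx1.
rewrite /char_poly; have -> : char_poly_mx (P *m A *m Q) = p *m char_poly_mx A *m q.
  rewrite /char_poly_mx mulmxBr mulmxBl !map_mxM /= -/p -/q.
  by rewrite scalar_mxC -(mulmxA _ p) pq mulmx1.
by rewrite !det_mulmx mulrC mulrA -det_mulmx qp det1 mul1r.
Qed.

Lemma char_poly_diag (R : comNzRingType) n (d : 'rV[R]_n) :
  char_poly (diag_mx d) = \prod_i ('X - (d 0 i)%:P).
Proof.
rewrite char_poly_trig ?is_diag_mx_is_trig ?diag_mx_is_diag //.
by apply: eq_bigr => i _; rewrite mxE eqxx mulr1n.
Qed.

(** The distinct entries of [d] are the roots, and the multiplicity of a root is the number of its
    occurrences in [d]. *)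
Lemma nuclear_norm_split (R : realType) n m (Y : 'M[R]_(n, m)) (d : 'rV[R]_n) :
  char_poly (Y *m Y^T) = \prod_i ('X - (d 0 i)%:P) ->
  nuclear_norm Y = \sum_i Num.sqrt (d 0 i).
Proof.
move=> pE; pose s := [seq d 0 i | i <- enum 'I_n].
have psE : char_poly (Y *m Y^T) = \prod_(x <- s) ('X - x%:P).
  by rewrite pE big_map big_enum.
have rE : perm_eq (rootsR (char_poly (Y *m Y^T))) (undup s).
  apply: uniq_perm; rewrite ?undup_uniq ?uniq_roots // => x.
  rewrite mem_undup -[RHS]root_prod_XsubC -psE.
  have p0 : char_poly (Y *m Y^T) != 0 by rewrite monic_neq0 ?char_poly_monic.
  by rewrite -(roots_on_rootsR p0) in_itv.
rewrite /nuclear_norm /singular_values /= big_flatten big_map (perm_big _ rE) /=.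
transitivity (\sum_(x <- s) Num.sqrt x); last by rewrite big_map big_enum.
rewrite -[RHS]big_undup_iterop_count /=; apply: eq_bigr => x _.
by rewrite psE mu_prod_XsubC big_nseq Monoid.iteropE.
Qed.

(** [P] plays the polar factor of [Y]: the eigenvalues of [Y *m Y^T] are the squares of those of
    [P], and the square root undoes the squaring because the latter are nonnegative. *)
Lemma nuclear_norm_psd (R : realType) n m (Y : 'M[R]_(n, m)) (P : 'M[R]_n) :
    P^T = P -> (forall v : 'rV_n, 0 <= (v *m P *m v^T) 0 0) ->
  Y *m Y^T = P *m P -> nuclear_norm Y = \tr P.
Proof.
move=> symP psdP YY; have [O [d [OOT OTO PE]]] := symmetric_spectral symP.
have d_ge0 i : 0 <= d 0 i.
  have := psdP (delta_mx 0 i *m O); rewrite PE trmx_mul !mulmxA.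
  rewrite -(mulmxA _ O) OOT mulmx1 -(mulmxA _ O) OOT mulmx1 -rowE.
  by rewrite row_diag_mx trmx_delta -scalemxAl mul_delta_mx !mxE mulr1.
rewrite (@nuclear_norm_split _ _ _ _ (\row_j (d 0 j * d 0 j))).
  rewrite PE mxtrace_mulC mulmxA OOT mul1mx mxtrace_diag.
  by apply: eq_bigr => i _; rewrite mxE -expr2 sqrtr_sqr ger0_norm.
rewrite YY PE !mulmxA -(mulmxA _ O) OOT mulmx1 -(mulmxA O^T) mulmx_diag.
by rewrite char_poly_conj // char_poly_diag.
Qed.

(** Diagonalizing [X *m X^T] makes the rows of [O *m X] pairwise orthogonal; normalizing the nonzero
    ones gives [Z]. *)
Lemma svd_square (R : realType) n m (X : 'M[R]_(n, m)) :
  exists (O : 'M[R]_n) (sig : 'rV[R]_n) (Z : 'M[R]_(n, m)),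
    [/\ O *m O^T = 1%:M, forall i, 0 <= sig 0 i, X = O^T *m diag_mx sig *m Z &
        Z *m Z^T = diag_mx (\row_i (sig 0 i != 0)%:R)].
Proof.
have [|O [d [OOT OTO XXE]]] := @symmetric_spectral R n (X *m X^T).
  by rewrite trmx_mul trmxK.
have [Y YE] : exists Y : 'M_(n, m), Y = O *m X by eexists.
have YY : Y *m Y^T = diag_mx d.
  rewrite YE trmx_mul mulmxA -(mulmxA O) XXE !mulmxA OOT mul1mx -mulmxA OOT.
  by rewrite mulmx1.
have dE i : d 0 i = \sum_j Y i j ^+ 2.
  move/matrixP/(_ i i): YY; rewrite !mxE eqxx mulr1n => <-.
  by apply: eq_bigr => j _; rewrite mxE -expr2.
have d_ge0 i : 0 <= d 0 i by rewrite dE sumr_ge0 // => j _; rewrite sqr_ge0.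
pose sig : 'rV[R]_n := \row_i Num.sqrt (d 0 i).
(* Since the inverse of 0 is 0, null rows of [Y] yield null rows of [Z], whence the indicator in
   [Z *m Z^T]. *)
pose tau : 'rV[R]_n := \row_i (Num.sqrt (d 0 i))^-1.
exists O, sig, (diag_mx tau *m Y); split=> // [i||].
- by rewrite mxE sqrtr_ge0.
- rewrite -mulmxA [diag_mx sig *m _]mulmxA mulmx_diag.
  suff -> : diag_mx (\row_i (sig 0 i * tau 0 i)) *m Y = Y by rewrite YE mulmxA OTO mul1mx.
  apply/matrixP => i j; rewrite mul_diag_mx !mxE.
  have [s0|s0] := eqVneq (Num.sqrt (d 0 i)) 0; last by rewrite mulfV // mul1r.
  rewrite s0 !mul0r; apply/esym/eqP.
  have : d 0 i == 0 by rewrite eq_le d_ge0 -sqrtr_eq0 s0 eqxx.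
  rewrite dE psumr_eq0 => [/allP/(_ j (mem_index_enum j))|k _]; last exact: sqr_ge0.
  by rewrite /= sqrf_eq0.
- rewrite trmx_mul tr_diag_mx mulmxA -(mulmxA _ Y) YY !mulmx_diag.
  congr diag_mx; apply/rowP => i; rewrite !mxE.
  rewrite -[in X in _ * X * _](sqr_sqrtr (d_ge0 i)).
  have [->|s0] := eqVneq; first by rewrite invr0 mulr0.
  by rewrite expr2 mulKf // mulfV.
Qed.

(** * Rank and dimension counts *)

Lemma mxrank_diag_le (F : fieldType) n (d : 'rV[F]_n) :
  (\rank (diag_mx d) <= #|[set i | d 0%R i != 0%R]|)%N.
Proof.
have -> : diag_mx d = \sum_(i in [set i | d 0 i != 0]) d 0 i *: delta_mx i i.
  rewrite diag_mx_sum_delta [LHS](bigID (fun i => d 0 i != 0)) /=.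
  rewrite [X in _ + X]big1 ?addr0 => [|i /negbNE/eqP->]; last by rewrite scale0r.
  by apply: eq_bigl => i; rewrite inE.
rewrite -sum1_card; elim/big_ind2: _ => [|A a B b lA lB|i _]; first by rewrite mxrank0.
  by rewrite (leq_trans (mxrank_add _ _)) // leq_add.
by rewrite (leq_trans (mxrank_scale _ _)) // mxrank_delta.
Qed.

Lemma exists_supported_kernel (F : fieldType) m n q
    (f : {linear 'M[F]_(m, n) -> 'rV[F]_q}) (T : {set 'I_m * 'I_n}) :
  (q < #|T|)%N ->
  exists U : 'M[F]_(m, n), [/\ U != 0, forall i j, (i, j) \notin T -> U i j = 0 & f U = 0].
Proof.
move=> ltqT; pose E k : 'M[F]_(m, n) := delta_mx (@enum_val _ (mem T) k).1 (enum_val k).2.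
(* The rows of [M] are the images of the basis of matrices supported on [T]; having more rows than
   columns, [M] has a nontrivial left kernel. *)
pose M := \matrix_k f (E k).
have : kermx M != 0.
  by rewrite kermx_eq0 /row_free neq_ltn (leq_ltn_trans (rank_leq_col _)).
case/rowV0Pn => v /sub_kermxP vM v0; pose U := \sum_k v 0 k *: E k.
have UE i j : U i j = \sum_k v 0 k * (enum_val k == (i, j))%:R.
  rewrite summxE; apply: eq_bigr => k _; rewrite !mxE.
  by rewrite [i == _]eq_sym [j == _]eq_sym; case: enum_val.
exists U; split.
- apply: contra_neq v0 => U0; apply/rowP => k; rewrite mxE.
  move/matrixP/(_ (enum_val k).1 (enum_val k).2): U0; rewrite UE mxE -surjective_pairing.
  rewrite (bigD1 k) //= eqxx mulr1 big1 ?addr0 // => l lk.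
  by rewrite (inj_eq enum_val_inj) (negPf lk) mulr0.
- move=> i j ijT; rewrite UE big1 // => k _.
  by case: eqP ijT => [<-|]; rewrite ?enum_valP ?mulr0.
- rewrite linear_sum -[RHS]vM mulmx_sum_row.
  by apply: eq_bigr => k _; rewrite linearZ rowK.
Qed.

(** The triangle and its mirror image cover the square and meet in the diagonal, which has [#|S|]
    elements. *)
Lemma card_upper_triangle n (S : {set 'I_n}) :
  (#|[set ij in finset.setX S S | ij.1 <= ij.2]|.*2 = #|S| * (#|S| + 1))%N.
Proof.
set T := [set _ in _ | _]; pose T' := (fun ij => (ij.2, ij.1)) @^-1: T.
have cT' : #|T'| = #|T|.
  by apply: on_card_preimset; exists (fun ij => (ij.2, ij.1)) => -[].
rewrite -addnn -[X in (_ + X)%N]cT' -cardsUI mulnDr muln1 -cardsX; congr (_ + _)%N.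
  apply: eq_card => -[i j]; rewrite !inE /=.
  by case: (i \in S); case: (j \in S); rewrite //= leq_total.
rewrite -(card_imset S (f := fun i => (i, i))); last by move=> i j [].
apply: eq_card => -[i j]; rewrite !inE /=; apply/idP/imsetP => [|[k kS [-> ->]]].
  case/andP=> /andP[/andP[iS _] ij] /andP[_ ji]; exists i => //.
  by congr (_, _); apply/val_inj/eqP; rewrite eqn_leq ji ij.
by rewrite kS leqnn.
Qed.

(** * Stability under small perturbations *)

Lemma exists_small_scale (R : realFieldType) (I : finType) (P : pred I) (a b : I -> R) :
    (forall i, P i -> 0 < b i) -> (forall i, 0 <= a i) ->
  exists2 e, 0 < e & forall i, P i -> e * a i <= b i.
Proof.
(* The sum bounds every ratio [a i / b i]; the 1 keeps [c] positive even if all of them vanish. *)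
move=> b_gt0 a_ge0; pose c := 1 + \sum_(i | P i) a i / b i.
have ab_ge0 i : P i -> 0 <= a i / b i by move=> Pi; rewrite divr_ge0 // ltW // b_gt0.
have c_gt0 : 0 < c by rewrite ltr_wpDr ?sumr_ge0.
exists c^-1; first by rewrite invr_gt0.
move=> i Pi; rewrite mulrC ler_pdivrMr // mulrC -ler_pdivrMr ?b_gt0 //.
rewrite /c (bigD1 i) //= addrCA lerDl addr_ge0 // sumr_ge0 // => j /andP[Pj _].
exact: ab_ge0.
Qed.

(** Both quadratic forms see only the coordinates of [v] in the support of [sig]. With [q] the
    squared norm of that part and [c] the l1-norm of [K], the form of [K] is at most [c * q] in
    absolute value, that of [diag_mx sig] at least [e * c * q]. *)
Lemma psd_small_perturbation (R : realFieldType) n (sig : 'rV[R]_n) (K : 'M[R]_n) :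
    (forall i, 0 <= sig 0 i) ->
    (forall i j, K i j != 0 -> sig 0 i != 0 /\ sig 0 j != 0) ->
  exists2 e, 0 < e & forall t, `|t| <= e -> forall v : 'rV_n,
    0 <= (v *m (diag_mx sig + t *: K) *m v^T) 0 0.
Proof.
move=> sig_ge0 KS; pose S i := sig 0 i != 0.
pose c := \sum_i \sum_j `|K i j|.
have c_ge0 : 0 <= c by rewrite !sumr_ge0 // => i _; rewrite sumr_ge0.
have [i|//|e e_gt0 le_sig] := @exists_small_scale R 'I_n S (fun=> c) (fun i => sig 0 i).
  by rewrite lt0r sig_ge0 andbT.
exists e => // t te v; pose q := \sum_(i | S i) v 0 i ^+ 2.
have le_q i : S i -> v 0 i ^+ 2 <= q.
  by move=> Si; rewrite /q (bigD1 i) //= lerDl sumr_ge0 // => j _; rewrite sqr_ge0.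
have vKv : `|(v *m K *m v^T) 0 0| <= c * q.
  rewrite mxE /c exchange_big mulr_suml (le_trans (ler_norm_sum _ _ _)) //.
  apply: ler_sum => j _; rewrite !mxE !mulr_suml (le_trans (ler_norm_sum _ _ _)) //.
  apply: ler_sum => i _; have [->|Kij] := eqVneq (K i j) 0.
    by rewrite mulr0 mul0r normr0 mul0r.
  have [Si Sj] := KS _ _ Kij.
  (* What remains is that the product of two coordinates is at most [q] in absolute value, as both
     squares are. *)
  rewrite [v 0 i * _]mulrC -mulrA normrM ler_wpM2l // ler_norml.
  by have := le_q i Si; have := le_q j Sj; nra.
have vsv : (v *m diag_mx sig *m v^T) 0 0 = \sum_(i | S i) sig 0 i * v 0 i ^+ 2.
  rewrite mxE [RHS]big_mkcond; apply: eq_bigr => i _.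
  rewrite mul_mx_diag !mxE /S mulrC mulrA mulrC -expr2.
  by case: eqVneq => //= ->; rewrite mul0r.
rewrite mulmxDr mulmxDl mxE vsv -scalemxAr -scalemxAl [X in _ + X]mxE.
have tvKv : `|t * (v *m K *m v^T) 0 0| <= e * c * q.
  by rewrite normrM -mulrA ler_pM.
have : e * c * q <= \sum_(i | S i) sig 0 i * v 0 i ^+ 2.
  by rewrite mulr_sumr ler_sum // => i Si; rewrite ler_wpM2r ?sqr_ge0 ?le_sig.
by move: tvKv; rewrite ler_norml => /andP[]; lra.
Qed.

(** While [t *: D] is entrywise no larger than [X], no entry changes sign and zero entries stay
    zero, so each absolute value is affine with slope [Num.sg (X i j) * D i j]. *)
Lemma l1_norm_locally_affine (R : realType) n m (X D : 'M[R]_(n, m)) :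
    (forall i j, X i j = 0 -> D i j = 0) ->
  exists2 e, 0 < e & exists c, forall t, `|t| <= e ->
    l1_norm (X + t *: D) = l1_norm X + t * c.
Proof.
move=> DX.
have [ij|//|e e_gt0 le_X] := @exists_small_scale R ('I_n * 'I_m)%type
    (fun ij => X ij.1 ij.2 != 0) (fun ij => `|D ij.1 ij.2|) (fun ij => `|X ij.1 ij.2|).
  by rewrite normr_gt0.
exists e => //; exists (\sum_i \sum_j Num.sg (X i j) * D i j) => t te.
rewrite /l1_norm mulr_sumr -big_split; apply: eq_bigr => i _.
rewrite mulr_sumr -big_split; apply: eq_bigr => j _ /=; rewrite !mxE.
have [X0|X0] := eqVneq (X i j) 0.
  by rewrite X0 DX // mulr0 addr0 normr0 sgr0 mul0r mulr0 addr0.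
have tD : `|t * D i j| <= `|X i j|.
  by rewrite normrM (le_trans _ (le_X (i, j) X0)) // ler_wpM2r.
case: (ltrgt0P (X i j)) X0 tD => // X0 _; rewrite ler_norml => /andP[lo hi].
- by rewrite gtr0_sg // ger0_norm ?mul1r //; lra.
- by rewrite ltr0_sg // ler0_norm; lra.
Qed.

(** * Extremality and the rank bound *)

Lemma extreme_minimizer_affine_direction (R : realType) n m d
    (A : {linear 'M[R]_(n, m) -> 'cV[R]_d}) (b : 'cV[R]_d) (f : 'M[R]_(n, m) -> R)
    (X D : 'M[R]_(n, m)) (e c : R) :
    extreme_point (minimizers f (feasible_set A b)) X -> A D = 0 -> 0 < e ->
    (forall t, `|t| <= e -> f (X + t *: D) = f X + t * c) ->
  D = 0.
Proof.
move=> [[AX minX] extX] AD e_gt0 fE.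
have feas t : A (X + t *: D) = b by rewrite linearD linearZ /= AX AD scaler0 addr0.
have feq t : `|t| <= e -> f (X + t *: D) = f X.
  move=> te; rewrite fE //; suff -> : c = 0 by rewrite mulr0 addr0.
  have e_norm : `|e| <= e by rewrite gtr0_norm.
  (* Minimality against both ends gives [e * c >= 0] and [- e * c >= 0]. *)
  have := minX _ (feas e); have := minX _ (feas (- e)).
  by rewrite !fE ?normrN //; nra.
have min t : `|t| <= e -> minimizers f (feasible_set A b) (X + t *: D).
  by move=> te; split=> [|Y AY]; [exact: feas|rewrite feq // minX].
have e_norm : `|e| <= e by rewrite gtr0_norm.
have [|||||/eqP XeD _] := extX (X + e *: D) (X + (- e) *: D) 2^-1.
- exact: min.
- by apply: min; rewrite normrN.
- lra.
- lra.
- rewrite [1 - _](_ : _ = 2^-1); last lra.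
  rewrite -scalerDr addrACA -scalerDl subrr scale0r addr0 -mulr2n -scaler_nat.
  by rewrite scalerA mulVf ?scale1r // pnatr_eq0.
by move: XeD; rewrite -subr_eq0 addrAC subrr add0r scaler_eq0 gt_eqF //= => /eqP.
Qed.

Lemma mulmx_diag_indicator (R : nzRingType) n (sig : 'rV[R]_n) (K : 'M[R]_n) :
    (forall i j, sig 0 j = 0 -> K i j = 0) ->
  K *m diag_mx (\row_i (sig 0 i != 0)%:R) = K.
Proof.
move=> KS; apply/matrixP => i j; rewrite mul_mx_diag !mxE.
by have [/KS->|_] := eqVneq; rewrite ?mul0r ?mulr1.
Qed.

(** Symmetrization is thus injective on upper triangular matrices, which can parametrize the
    symmetric [K]. *)
Lemma upper_triangular_add_tr_eq0 (R : numDomainType) n (U : 'M[R]_n) :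
  (forall i j : 'I_n, (j < i)%N -> U i j = 0) -> U + U^T = 0 -> U = 0.
Proof.
move=> upU /matrixP UUT; apply/matrixP => i j; rewrite mxE.
have := UUT i j; rewrite !mxE; case: (ltngtP i j) => [/upU->|/upU->//|/val_inj->].
  by rewrite addr0.
by move/eqP; rewrite -mulr2n mulrn_eq0 => /eqP.
Qed.

Theorem theorem3p4 (R : realType) (n m d : nat) (hnm : (n <= m)%N)
  (A : {linear 'M[R]_(n, m) -> 'cV[R]_d}) (b : 'cV[R]_d)
  (theta : R) (htheta : 0 < theta) (X : 'M[R]_(n, m))
  (hX : extreme_point (minimizers (objective theta) (feasible_set A b)) X) :
  (\rank X * (\rank X + 1))%:R / 2 - #|zero_entries X|%:R <= 1 + d%:R :> R.
Proof.
have [O [sig [Z [OOT sig_ge0 XE ZZT]]]] := svd_square X.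
have OTO : O^T *m O = 1%:M by exact: mulmx1C.
pose S := [set i | sig 0 i != 0].
pose T := [set ij in finset.setX S S | (ij.1 <= ij.2)%N].
have rankX : (\rank X <= #|S|)%N.
  by rewrite XE (leq_trans (mxrankM_maxl _ _)) // (leq_trans (mxrankM_maxr _ _)) // mxrank_diag_le.
rewrite leNgt; apply/negP => big_rank.
have ltT : (d + #|zero_entries X| < #|T|)%N.
  have le_rT : (\rank X * (\rank X + 1) <= #|T|.*2)%N.
    by rewrite card_upper_triangle leq_mul // leq_add2r.
  move: le_rT; rewrite -(ler_nat R) -muln2 [X in _ <= X]natrM -(ltr_nat R) natrD.
  by move: big_rank; lra.
(* The unknown is [U] supported on the upper triangle [T], with [K = U + U^T]; [f] gathers the
   conditions that [A] kills [D U] and that [D U] vanishes on the zero entries of [X]. *)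
pose D (U : 'M[R]_n) := O^T *m (U + U^T) *m Z.
pose f U : 'rV[R]_(d + #|zero_entries X|) :=
  row_mx (A (D U))^T (\row_k D U (@enum_val _ (mem (zero_entries X)) k).1 (enum_val k).2).
have linD : linear D.
  move=> a U V; rewrite /D !linearP /= addrACA -scalerDr mulmxDr -scalemxAr.
  by rewrite mulmxDl -scalemxAl.
have linf : linear f.
  move=> a U V; rewrite /f linD !linearP /= scale_row_mx add_row_mx.
  by congr row_mx; apply/rowP => k; rewrite !mxE.
pose F : {linear 'M[R]_n -> 'rV[R]_(d + #|zero_entries X|)} :=
  HB.pack f (GRing.isLinear.Build _ _ _ _ f linf).
have [U [U0 UT]] := @exists_supported_kernel _ _ _ _ F T ltT.
rewrite /= -[RHS]row_mx0 => /eq_row_mx[/eqP]; rewrite trmx_eq0 => /eqP AD DI.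
have DX i j : X i j = 0 -> D U i j = 0.
  move=> Xij; have ijI : (i, j) \in zero_entries X by rewrite inE Xij /=.
  by move/rowP/(_ (enum_rank_in ijI (i, j))): DI; rewrite !mxE enum_rankK_in.
pose K := U + U^T.
have symK : K^T = K by rewrite linearD /= trmxK addrC.
have US i j : U i j != 0 -> sig 0 i != 0 /\ sig 0 j != 0.
  move=> Uij; have : (i, j) \in T by apply: contraNT Uij => /UT->.
  by rewrite !inE => /andP[/andP[]].
have KS i j : K i j != 0 -> sig 0 i != 0 /\ sig 0 j != 0.
  rewrite !mxE; have [->|/US//] := eqVneq (U i j) 0.
  by rewrite add0r => /US[].
have KS0 i j : sig 0 j = 0 -> K i j = 0.
  by move=> sj; apply/eqP/contraT => /KS[_]; rewrite sj eqxx.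
have DU0 : D U != 0.
  apply: contra_neq U0 => D0; apply: upper_triangular_add_tr_eq0.
    by move=> i j ji; apply: UT; rewrite inE /= negb_and -ltnNge ji orbT.
  (* This recovers [K] from [D U], as [Z *m Z^T] is the projection onto the support of [sig], where
     [K] lives. *)
  have := congr1 (fun M => O *m M *m Z^T) D0.
  rewrite /D -/K !mulmxA OOT mul1mx -mulmxA ZZT mulmx0 mul0mx.
  by rewrite mulmx_diag_indicator.
have [e1 e1_gt0 psd] := psd_small_perturbation sig_ge0 KS.
have [e2 e2_gt0 [c l1E]] := l1_norm_locally_affine DX.
have nucE t : `|t| <= e1 -> nuclear_norm (X + t *: D U) = \tr (diag_mx sig) + t * \tr K.
  move=> te; pose Q := diag_mx sig + t *: K.
  have symQ : Q^T = Q by rewrite linearD linearZ /= tr_diag_mx symK.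
  have -> : X + t *: D U = O^T *m Q *m Z.
    by rewrite XE /D -/K [O^T *m (_ + t *: K)]mulmxDr mulmxDl -scalemxAr -scalemxAl.
  (* The polar factor: its square is the Gram matrix of [O^T *m Q *m Z] because
     [Q *m (Z *m Z^T) = Q]. *)
  rewrite (@nuclear_norm_psd _ _ _ _ (O^T *m Q *m O)).
  - by rewrite mxtrace_mulC mulmxA OOT mul1mx linearD linearZ.
  - by rewrite !trmx_mul trmxK symQ mulmxA.
  - by move=> v; have := psd t te (v *m O^T); rewrite trmx_mul trmxK !mulmxA.
  rewrite !trmx_mul trmxK symQ !mulmxA -(mulmxA _ Z) ZZT -(mulmxA _ O) OOT mulmx1.
  congr (_ *m _ *m _); rewrite -mulmxA mulmx_diag_indicator // => i j sj.
  rewrite mxE [X in _ + X]mxE KS0 // mulr0 addr0 mxE.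
  by case: eqVneq => [->|_]; rewrite ?sj ?mul0rn.
case/eqP: DU0; pose e := Num.min e1 e2.
apply: (@extreme_minimizer_affine_direction _ _ _ _ A b (objective theta) X _ e
  (c + theta * \tr K)) => //; first by rewrite lt_min e1_gt0.
move=> t; rewrite le_min => /andP[te1 te2].
have nucX : nuclear_norm X = \tr (diag_mx sig).
  by have := nucE 0; rewrite scale0r addr0 mul0r addr0 normr0; apply; exact: ltW.
by rewrite /objective l1E // nucE // nucX; ring.
Qed.
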